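(* Let $M$ and $V$ be two Malcev algebras over $\mathbb{F}$, with two bilinear maps $\triangleleft:M\times V\to M$ and $\omega:V\times V\to M$, where $\omega$ is skew-symmetric. Define on the vector space $M\oplus V$ the bracket $$[(x,u),(y,v)]=\big([x,y]+x\triangleleft v-y\triangleleft u+\omega(u,v),\ [u,v]\big)\qquad (x,y\in M,\ u,v\in V).$$ Then $M\oplus V$ is a Malcev algebra under this bracket if and only if the following conditions hold for all $x,y,z\in M$ and $u,v,p,q\in V$: (CP1) $[[x,z],y\triangleleft q]=[[x,y],z]\triangleleft q+[[y,z]\triangleleft q,x]+[[z\triangleleft q,x],y]-[[x\triangleleft q,y],z]$; (CP2) $[[x,z],\omega(v,q)]+[x,z]\triangleleft[v,q]=[x\triangleleft v,z]\triangleleft q-[(z\triangleleft v)\triangleleft q,x]+[z\triangleleft q,x]\triangleleft v-[(x\triangleleft q)\triangleleft v,z]$; (CP3) $[x\triangleleft p,y\triangleleft q]=([x,y]\triangleleft p)\triangleleft q+[(y\triangleleft p)\triangleleft q,x]+[[\omega(p,q),x],y]-[x\triangleleft[p,q],y]-[x\triangleleft q,y]\triangleleft p$; (CP4) $[x\triangleleft p,\omega(v,q)]+(x\triangleleft p)\triangleleft[v,q]=((x\triangleleft v)\triangleleft p)\triangleleft q-x\triangleleft[[v,p],q]+[\omega(v,p)\triangleleft q,x]+[\omega([v,p],q),x]+[\omega(p,q),x]\triangleleft v-(x\triangleleft[p,q])\triangleleft v-((x\triangleleft q)\triangleleft v)\triangleleft p$; (CP5) $[\omega(u,p),y\triangleleft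 q]-(y\triangleleft q)\triangleleft[u,p]=-((y\triangleleft u)\triangleleft p)\triangleleft q+((y\triangleleft p)\triangleleft q)\triangleleft u+[\omega(p,q)\triangleleft u,y]+[\omega([p,q],u),y]-y\triangleleft[[p,q],u]+[\omega(q,u),y]\triangleleft p-(y\triangleleft[q,u])\triangleleft p$; (CP6) $[\omega(u,p),\omega(v,q)]+\omega(u,p)\triangleleft[v,q]-\omega(v,q)\triangleleft[u,p]+\omega([u,p],[v,q])=(\omega(u,v)\triangleleft p)\triangleleft q+\omega([u,v],p)\triangleleft q+\omega([[u,v],p],q)+(\omega(v,p)\triangleleft q)\triangleleft u+\omega([v,p],q)\triangleleft u+\omega([[v,p],q],u)+(\omega(p,q)\triangleleft u)\triangleleft v+\omega([p,q],u)\triangleleft v+\omega([[p,q],u],v)+(\omega(q,u)\triangleleft v)\triangleleft p+\omega([q,u],v)\triangleleft p+\omega([[q,u],v],p)$.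
   Context: All algebras and vector spaces are over an algebraically closed field $\mathbb{F}$ of characteristic different from $2$ and $3$. A Malcev algebra is a vector space $M$ with a bilinear operation $[\,,\,]:M\times M\to M$ such that $[x,y]=-[y,x]$ and $J(x,y,[x,z])=[J(x,y,z),x]$ for all $x,y,z\in M$, where $J(x,y,z)=[[x,y],z]+[[y,z],x]+[[z,x],y]$. The bracket symbol $[\,,\,]$ denotes the bracket of $M$ on elements of $M$ and the bracket of $V$ on elements of $V$. When the conditions hold, the resulting Malcev algebra is called the crossed product of $M$ and $V$. *)

(* Defs.v *)
From mathcomp Require Import all_boot all_order all_algebra.

Set Implicit Arguments.
Unset Strict Implicit.
Unset Printing Implicit Defensive.

Import GRing.Theory.
Local Open Scope ring_scope.

Definition jacobian (T : zmodType) (br : T -> T -> T) (x y z : T) : T :=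
  br (br x y) z + br (br y z) x + br (br z x) y.

(* Bilinearity of the bracket is part of the notion; the space [T] may be
   infinite-dimensional. *)
Record malcev_algebra (F : fieldType) (T : lmodType F) (br : T -> T -> T)
    : Prop := MalcevAlgebra {
  malcev_bilinear : bilinear_for *:%R *:%R br;
  malcev_anticomm : forall x y : T, br x y = - br y x;
  malcev_identity : forall x y z : T,
    jacobian br x y (br x z) = br (jacobian br x y z) x
}.

Section CrossedProduct.

Context (F : fieldType) (M V : lmodType F).
Context (brM : M -> M -> M) (brV : V -> V -> V).
Context (tri : M -> V -> M) (omega : V -> V -> M).

Local Notation "[M x , y ]" := (brM x y)
  (at level 0, x, y at level 99, format "[M  x ,  y ]").
Local Notation "[V u , v ]" := (brV u v)
  (at level 0, u, v at level 99, format "[V  u ,  v ]").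
Local Notation "x ◁ v" := (tri x v) (at level 40, left associativity).
Local Notation ω := omega.

Definition crossed_bracket (a b : M * V) : M * V :=
  ([M a.1, b.1] + a.1 ◁ b.2 - b.1 ◁ a.2 + ω a.2 b.2, [V a.2, b.2]).

Record crossed_product_conditions : Prop := CrossedProductConditions {
  CP1 : forall (x y z : M) (q : V),
    [M [M x, z], y ◁ q]
    = [M [M x, y], z] ◁ q + [M [M y, z] ◁ q, x]
      + [M [M z ◁ q, x], y] - [M [M x ◁ q, y], z];
  CP2 : forall (x z : M) (v q : V),
    [M [M x, z], ω v q] + [M x, z] ◁ [V v, q]
    = [M x ◁ v, z] ◁ q - [M (z ◁ v) ◁ q, x]
      + [M z ◁ q, x] ◁ v - [M (x ◁ q) ◁ v, z];
  CP3 : forall (x y : M) (p q : V),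
    [M x ◁ p, y ◁ q]
    = ([M x, y] ◁ p) ◁ q + [M (y ◁ p) ◁ q, x]
      + [M [M ω p q, x], y] - [M x ◁ [V p, q], y] - [M x ◁ q, y] ◁ p;
  CP4 : forall (x : M) (v p q : V),
    [M x ◁ p, ω v q] + (x ◁ p) ◁ [V v, q]
    = ((x ◁ v) ◁ p) ◁ q - x ◁ [V [V v, p], q]
      + [M ω v p ◁ q, x] + [M ω [V v, p] q, x]
      + [M ω p q, x] ◁ v - (x ◁ [V p, q]) ◁ v - ((x ◁ q) ◁ v) ◁ p;
  CP5 : forall (y : M) (u p q : V),
    [M ω u p, y ◁ q] - (y ◁ q) ◁ [V u, p]
    = - (((y ◁ u) ◁ p) ◁ q) + ((y ◁ p) ◁ q) ◁ u
      + [M ω p q ◁ u, y] + [M ω [V p, q] u, y] - y ◁ [V [V p, q], u]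
      + [M ω q u, y] ◁ p - (y ◁ [V q, u]) ◁ p;
  CP6 : forall u v p q : V,
    [M ω u p, ω v q] + ω u p ◁ [V v, q] - ω v q ◁ [V u, p]
      + ω [V u, p] [V v, q]
    = (ω u v ◁ p) ◁ q + ω [V u, v] p ◁ q + ω [V [V u, v], p] q
      + (ω v p ◁ q) ◁ u + ω [V v, p] q ◁ u + ω [V [V v, p], q] u
      + (ω p q ◁ u) ◁ v + ω [V p, q] u ◁ v + ω [V [V p, q], u] v
      + (ω q u ◁ v) ◁ p + ω [V q, u] v ◁ p + ω [V [V q, u], v] p
}.

End CrossedProduct.

(* Main.v *)
(** Call [s(x,y,z,t)] the difference of the two sides of Sagle's identity
    [[x,z],[y,t]] = [[[x,y],z],t] + [[[y,z],t],x] + [[[z,t],x],y] + [[[t,x],y],z].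
    For an anticommutative bilinear bracket, [s] is multilinear, invariant under
    cyclic shifts, and the Malcev identity says exactly that [s(x,y,z,x) = 0].
    Polarizing, [s] changes sign under every transposition of (cyclically)
    adjacent arguments; a 4-cycle being a product of three of these, also
    [s = - s], so [s = 0] in characteristic not 2.  Thus Malcev algebras are the
    anticommutative algebras with [s = 0].  By multilinearity, [s = 0] on
    [M * V] need only be tested on arguments taken from [M] or from [V], and
    (CP1)-(CP6) are its [M]-components on the types MMMV, MVMV, MMVV, MVVV, VMVV
    and VVVV, which up to cyclic shifts are all the types other than MMMM. *)

Require Import Defs.
From HB Require Import structures.
From mathcomp Require Import all_boot all_order all_algebra.

Local Open Scope ring_scope.

Import GRing.Theory.

Section Sagle.

Context {F : fieldType} {T : lmodType F}.

Definition sagle_defect (br : T -> T -> T) (x y z t : T) : T :=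
  br (br x z) (br y t)
  - (br (br (br x y) z) t + br (br (br y z) t) x
     + br (br (br z t) x) y + br (br (br t x) y) z).

Context {br : {bilinear T -> T -> T}}.

Local Notation s := (sagle_defect br).

Lemma sagle_defectDl x x' y z t : s (x + x') y z t = s x y z t + s x' y z t.
Proof.
rewrite /sagle_defect !(linearDl, linearDr) [RHS]addrACA -opprD.
by congr (_ - _); do 3!(rewrite [RHS]addrACA; congr (_ + _)).
Qed.

Hypothesis anti : forall x y, br x y = - br y x.

(** The shift permutes the four quartic summands cyclically, and it turns [br (br x z) (br y t)]
    into [br (br y t) (br z x)], where two sign changes cancel. *)
Lemma sagle_defect_cyc x y z t : s x y z t = s y z t x.
Proof.
rewrite /sagle_defect (anti (br y t)) (anti z x) linearNl opprK.
by congr (_ - _); rewrite [RHS]addrC !addrA.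
Qed.

Lemma sagle_defectD2 x y y' z t : s x (y + y') z t = s x y z t + s x y' z t.
Proof. by rewrite !(sagle_defect_cyc x) sagle_defectDl. Qed.

Lemma sagle_defectD3 x y z z' t : s x y (z + z') t = s x y z t + s x y z' t.
Proof. by rewrite !(sagle_defect_cyc x) sagle_defectD2. Qed.

Lemma sagle_defectD4 x y z t t' : s x y z (t + t') = s x y z t + s x y z t'.
Proof. by rewrite !(sagle_defect_cyc x) sagle_defectD3. Qed.

(** The arguments are split into elements of [P] one at a time, using additivity in each slot. *)
Lemma sagle_defect_eq0_of_span (P : T -> Prop) :
  (forall x, exists y z, [/\ P y, P z & x = y + z]) ->
  (forall x y z t, P x -> P y -> P z -> P t -> s x y z t = 0) ->
  forall x y z t, s x y z t = 0.
Proof.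
move=> spanP s0.
have s1 x y z t : P y -> P z -> P t -> s x y z t = 0.
  move=> Py Pz Pt; have [a [b [Pa Pb ->]]] := spanP x.
  by rewrite sagle_defectDl !s0 ?addr0.
have s2 x y z t : P z -> P t -> s x y z t = 0.
  move=> Pz Pt; have [a [b [Pa Pb ->]]] := spanP y.
  by rewrite sagle_defectD2 !s1 ?addr0.
have s3 x y z t : P t -> s x y z t = 0.
  move=> Pt; have [a [b [Pa Pb ->]]] := spanP z.
  by rewrite sagle_defectD3 !s2 ?addr0.
move=> x y z t; have [a [b [Pa Pb ->]]] := spanP t.
by rewrite sagle_defectD4 !s3 ?addr0.
Qed.

Hypothesis char_neq2 : 2%N \notin [pchar F].

Lemma eq_opp_eq0 (x : T) : x = - x -> x = 0.
Proof.
move/eqP; rewrite -addr_eq0 -mulr2n -scaler_nat scaler_eq0 => /orP[|/eqP //].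
by move=> two0; case/negP: char_neq2; rewrite inE.
Qed.

(** With the fourth argument equal to [x], the summand containing [br x x] dies, and both Jacobian
    terms expand to contain [br (br (br z x) y) x], which cancels. *)
Lemma sagle_defect_malcev x y z :
  s x y z x = jacobian br x y (br x z) - br (jacobian br x y z) x.
Proof.
have -> : s x y z x = br (br x y) (br x z)
    - (br (br (br x y) z) x + br (br (br y z) x) x + br (br (br z x) x) y).
  rewrite /sagle_defect (eq_opp_eq0 _ (anti x x)) !linear0l addr0.
  by rewrite (anti y x) linearNr -anti.
rewrite /jacobian !linearDl (anti y (br x z)) (anti x z) !(linearNl, linearNr) !opprK.
set A := br (br x y) _; set B := br _ x; set C := br _ x.
set D := br _ y; set E := br _ x.
rewrite (addrAC _ E) (opprD _ E) addrA (addrAC _ E) addrK.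
by rewrite -[RHS]addrA -[in RHS]opprD (addrC D).
Qed.

Lemma malcev_sagle_defect :
  malcev_algebra br <-> forall x y z t, s x y z t = 0.
Proof.
split=> [[_ _ idM] | s0]; last first.
  split=> //; first by split=> u a x y; rewrite ?linearPl ?linearPr.
  by move=> x y z; apply/subr0_eq; rewrite -sagle_defect_malcev.
have s_alt x y z : s x y z x = 0 by rewrite sagle_defect_malcev idM subrr.
have swap14 x y z t : s x y z t = - s t y z x.
  apply/eqP; rewrite -addr_eq0; apply/eqP.
  (* Expanding in the outer arguments leaves only the two cross terms. *)
  have := s_alt (x + t) y z.
  by rewrite sagle_defectDl !sagle_defectD4 !s_alt addr0 add0r.
(* Each further swap is an earlier one conjugated by the cyclic shift. *)
have swap12 x y z t : s x y z t = - s y x z t.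
  by rewrite (sagle_defect_cyc x) swap14 -(sagle_defect_cyc y).
have swap23 x y z t : s x y z t = - s x z y t.
  by rewrite !(sagle_defect_cyc x) swap12.
have swap34 x y z t : s x y z t = - s x y t z.
  by rewrite !(sagle_defect_cyc x) swap23.
move=> x y z t.
apply/eq_opp_eq0.
by rewrite {1}swap12 swap23 swap34 !opprK (sagle_defect_cyc x).
Qed.

End Sagle.

Section CrossedProduct.

Context {F : fieldType} {M V : lmodType F}.
Context {brM : {bilinear M -> M -> M}} {brV : {bilinear V -> V -> V}}.
Context {tri : {bilinear M -> V -> M}} {omega : {bilinear V -> V -> M}}.

Local Notation cb := (crossed_bracket brM brV tri omega).

Lemma crossed_bracket_bilinear : bilinear_for *:%R *:%R cb.
Proof.
split=> c a b d; rewrite /crossed_bracket /= !(linearPl, linearPr);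
  congr (_, _) => /=; rewrite !scalerDr scalerN opprD -!scalerN;
  by do 3!(rewrite [RHS]addrACA; congr (_ + _)).
Qed.

HB.instance Definition _ :=
  bilinear_isBilinear.Build F (M * V)%type (M * V)%type (M * V)%type
    *:%R *:%R cb crossed_bracket_bilinear.

Hypothesis antiM : forall x y, brM x y = - brM y x.
Hypothesis antiV : forall u v, brV u v = - brV v u.
Hypothesis anti_omega : forall u v, omega u v = - omega v u.

Lemma crossed_bracket_anti a b : cb a b = - cb b a.
Proof.
rewrite /crossed_bracket antiM antiV anti_omega; congr (_, _) => /=.
by rewrite !opprD opprK; congr (_ + _); rewrite addrAC.
Qed.

Hypothesis sagleM : forall x y z t, sagle_defect brM x y z t = 0.
Hypothesis sagleV : forall u v p q, sagle_defect brV u v p q = 0.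

Let zeroE :=
  (linear0l brM, linear0r brM, linear0l brV, linear0r brV, linear0l tri,
   linear0r tri, linear0l omega, linear0r omega, subr0, sub0r, addr0, add0r,
   oppr0).
Let linearE := (linearNl brM, linearDl brM, linearNl tri, linearDl tri).
Let zmodE := (@opprK, addrA, opprD).

Local Notation "[M x , y ]" := (brM x y)
  (at level 0, x, y at level 99, format "[M  x ,  y ]").
Local Notation "[V u , v ]" := (brV u v)
  (at level 0, u, v at level 99, format "[V  u ,  v ]").
Local Notation "x ◁ v" := (tri x v) (at level 40, left associativity).
Local Notation ω := omega.

Local Notation s := (sagle_defect cb).

Lemma sagle_crossed_bracket :
  (forall a b c d, s a b c d = 0)
  <-> crossed_product_conditions brM brV tri omega.
Proof.
have E1 x y z q : (s (x, 0) (y, 0) (z, 0) (0, q)).1 =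
    [M [M x, z], y ◁ q]
    - ([M [M x, y], z] ◁ q + [M [M y, z] ◁ q, x]
      + [M [M z ◁ q, x], y] - [M [M x ◁ q, y], z]).
  by rewrite /sagle_defect /= !zeroE !linearE !zmodE.
have E2 x z v q : (s (x, 0) (0, v) (z, 0) (0, q)).1 =
    [M [M x, z], ω v q] + [M x, z] ◁ [V v, q]
    - ([M x ◁ v, z] ◁ q - [M (z ◁ v) ◁ q, x]
      + [M z ◁ q, x] ◁ v - [M (x ◁ q) ◁ v, z]).
  by rewrite /sagle_defect /= !zeroE !linearE !zmodE.
have E3 x y p q : (s (x, 0) (y, 0) (0, p) (0, q)).1 =
    [M x ◁ p, y ◁ q]
    - (([M x, y] ◁ p) ◁ q + [M (y ◁ p) ◁ q, x]
      + [M [M ω p q, x], y] - [M x ◁ [V p, q], y] - [M x ◁ q, y] ◁ p).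
  by rewrite /sagle_defect /= !zeroE !linearE !zmodE.
have E4 x v p q : (s (x, 0) (0, v) (0, p) (0, q)).1 =
    [M x ◁ p, ω v q] + (x ◁ p) ◁ [V v, q]
    - (((x ◁ v) ◁ p) ◁ q - x ◁ [V [V v, p], q]
      + [M ω v p ◁ q, x] + [M ω [V v, p] q, x]
      + [M ω p q, x] ◁ v - (x ◁ [V p, q]) ◁ v - ((x ◁ q) ◁ v) ◁ p).
  rewrite /sagle_defect /= !zeroE !linearE !zmodE.
  (* The two sides now differ only in the position of this summand, which moves two places to the
     right. *)
  by do 2!rewrite [in RHS](addrAC _ (x ◁ [V [V v, p], q])).
have E5 y u p q : (s (0, u) (y, 0) (0, p) (0, q)).1 =
    [M ω u p, y ◁ q] - (y ◁ q) ◁ [V u, p]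
    - (- (((y ◁ u) ◁ p) ◁ q) + ((y ◁ p) ◁ q) ◁ u
      + [M ω p q ◁ u, y] + [M ω [V p, q] u, y] - y ◁ [V [V p, q], u]
      + [M ω q u, y] ◁ p - (y ◁ [V q, u]) ◁ p).
  by rewrite /sagle_defect /= !zeroE !linearE !zmodE.
have E6 u v p q : (s (0, u) (0, v) (0, p) (0, q)).1 =
    [M ω u p, ω v q] + ω u p ◁ [V v, q] - ω v q ◁ [V u, p]
    + ω [V u, p] [V v, q]
    - ((ω u v ◁ p) ◁ q + ω [V u, v] p ◁ q + ω [V [V u, v], p] q
      + (ω v p ◁ q) ◁ u + ω [V v, p] q ◁ u + ω [V [V v, p], q] u
      + (ω p q ◁ u) ◁ v + ω [V p, q] u ◁ v + ω [V [V p, q], u] v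
      + (ω q u ◁ v) ◁ p + ω [V q, u] v ◁ p + ω [V [V q, u], v] p).
  by rewrite /sagle_defect /= !zeroE !linearE !zmodE.
split=> [s0 | [H1 H2 H3 H4 H5 H6]].
  by split=> *; apply/subr0_eq; rewrite -(E1, E2, E3, E4, E5, E6) s0.
(* The type MMMM is Sagle's identity in [M], since [M] embeds as a subalgebra. *)
have E0 x y z t : (s (x, 0) (y, 0) (z, 0) (t, 0)).1 = sagle_defect brM x y z t.
  by rewrite /sagle_defect /= !zeroE.
(* The projection to [V] preserves brackets, so the second component of the defect always vanishes
   and only the first needs the conditions. *)
have s2 a b c d : (s a b c d).2 = sagle_defect brV a.2 b.2 c.2 d.2 by [].
have s_eq0 a b c d : (s a b c d).1 = 0 -> s a b c d = 0.
  by move=> s1; rewrite [LHS]surjective_pairing s1 s2 sagleV.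
apply: (sagle_defect_eq0_of_span crossed_bracket_anti
  (fun a => (exists x, a = (x, 0)) \/ (exists u, a = (0, u)))).
  move=> [x u]; exists (x, 0), (0, u); split; [by left; exists x | by right; exists u |].
  by congr (_, _); rewrite ?addr0 ?add0r.
have cyc := sagle_defect_cyc crossed_bracket_anti.
have Z0 x y z t : s (x, 0) (y, 0) (z, 0) (t, 0) = 0.
  by apply: s_eq0; rewrite E0 sagleM.
have Z1 x y z q : s (x, 0) (y, 0) (z, 0) (0, q) = 0.
  by apply: s_eq0; rewrite E1 H1 subrr.
have Z2 x z v q : s (x, 0) (0, v) (z, 0) (0, q) = 0.
  by apply: s_eq0; rewrite E2 H2 subrr.
have Z3 x y p q : s (x, 0) (y, 0) (0, p) (0, q) = 0.
  by apply: s_eq0; rewrite E3 H3 subrr.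
have Z4 x v p q : s (x, 0) (0, v) (0, p) (0, q) = 0.
  by apply: s_eq0; rewrite E4 H4 subrr.
have Z6 u v p q : s (0, u) (0, v) (0, p) (0, q) = 0.
  by apply: s_eq0; rewrite E6 H6 subrr.
(* The sixteen types come in lexicographic order, M before V; the number of [cyc] rewrites is the
   shift taking a type to its representative MMMV, MVMV, MMVV or MVVV. *)
move=> _ _ _ _ [][a ->] [][b ->] [][c ->] [][d ->].
- exact: Z0.
- exact: Z1.
- do 3!rewrite cyc; exact: Z1.
- exact: Z3.
- do 2!rewrite cyc; exact: Z1.
- exact: Z2.
- do 3!rewrite cyc; exact: Z3.
- exact: Z4.
- rewrite cyc; exact: Z1.
- rewrite cyc; exact: Z3.
- rewrite cyc; exact: Z2.
- rewrite cyc; exact: Z4.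
- do 2!rewrite cyc; exact: Z3.
- do 2!rewrite cyc; exact: Z4.
- do 3!rewrite cyc; exact: Z4.
- exact: Z6.
Qed.

End CrossedProduct.

Theorem mainTheorem5 (F : closedFieldType)
    (char_neq2 : 2%N \notin [pchar F]) (char_neq3 : 3%N \notin [pchar F])
    (M V : lmodType F) (brM : M -> M -> M) (brV : V -> V -> V)
    (malcevM : malcev_algebra brM) (malcevV : malcev_algebra brV)
    (tri : {bilinear M -> V -> M}) (omega : {bilinear V -> V -> M})
    (omega_skew : forall u v : V, omega u v = - omega v u) :
  malcev_algebra (crossed_bracket brM brV tri omega)
  <-> crossed_product_conditions brM brV tri omega.
Proof.
have [bilM antiM _] := malcevM; have [bilV antiV _] := malcevV.
(* The raw brackets are bundled with their bilinearity so that the results on the Sagle defect apply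
   to them. *)
pose brM' : {bilinear M -> M -> M} :=
  HB.pack brM (bilinear_isBilinear.Build F M M M *:%R *:%R brM bilM).
pose brV' : {bilinear V -> V -> V} :=
  HB.pack brV (bilinear_isBilinear.Build F V V V *:%R *:%R brV bilV).
have sagleM := (malcev_sagle_defect (br := brM') antiM char_neq2).1 malcevM.
have sagleV := (malcev_sagle_defect (br := brV') antiV char_neq2).1 malcevV.
(* Sagle's identity on [M * V] is the middle term of the equivalence. *)
apply: iff_trans (sagle_crossed_bracket (brM := brM') (brV := brV')
  antiM antiV omega_skew sagleM sagleV).
exact: malcev_sagle_defect (crossed_bracket_anti (brM := brM') (brV := brV')
  antiM antiV omega_skew) char_neq2.
Qed.
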